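(* Let $L>0$ and $r\in(0,1)$, and for each integer $M\ge 1$ let the actuator centers be $$c_j^M:=\frac{(2j-1)L}{2M},\qquad j\in\{1,2,\dots,M\}.$$ Let $\omega_j^M:=\big(c_j^M-\tfrac{rL}{2M},c_j^M+\tfrac{rL}{2M}\big)$, let $U(c^M):=\operatorname{span}\{1_{\omega_j^M}\mid 1\le j\le M\}$, and let $E_M\subset L^2(0,L)$ be the linear span of the first $M$ Neumann eigenfunctions of $-\Delta$ on $(0,L)$. Then the oblique projection $P_{U(c^M)}^{E_M^\perp}:L^2(0,L)\to L^2(0,L)$ is well defined and its operator norm is $$\Big\|P_{U(c^M)}^{E_M^\perp}\Big\|=\left(\frac{4M^2}{r\pi^2(M-1)^2}\sin^2\left(\frac{r\pi(M-1)}{2M}\right)\right)^{-\frac12}\qquad\text{for } M\ge 2.$$ In particular, the sequence $\big\{\|P_{U(c^M)}^{E_M^\perp}\|\big\}_{M\ge 2}$ increases and converges to $\dfrac{\sqrt r\,\pi}{2\sin\left(\frac{r\pi}{2}\right)}$.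
   Context: $1_\omega$ is the indicator function of $\omega$. The Neumann eigenfunctions of $-\Delta=-\frac{d^2}{dx^2}$ on $(0,L)$ are ordered by increasing eigenvalue, starting with the eigenvalue $0$; the $i$-th one is a multiple of $\cos((i-1)\pi x/L)$, $i\ge1$. $E_M^\perp$ is the orthogonal complement of $E_M$ in $L^2(0,L)$. $\|\cdot\|$ is the operator norm in $\mathcal L(L^2(0,L))$. Oblique projection: if a Hilbert space $H$ is a direct sum $H=F\oplus E$ of closed subspaces, $P_F^E:H\to F$ is the projection onto $F$ along $E$, i.e. $P_F^Ex=x_F$ where $x=x_F+x_E$ is the unique decomposition with $(x_F,x_E)\in F\times E$. The projection is well defined exactly when the direct sum holds. *)

(* Defs.v *)
From HB Require Import structures.
From mathcomp Require Export all_boot all_order all_algebra.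
From mathcomp Require Export all_classical all_reals all_analysis.

Set Implicit Arguments.
Unset Strict Implicit.
Unset Printing Implicit Defensive.

Export Order.TTheory GRing.Theory Num.Theory.
Export numFieldNormedType.Exports.

Open Scope classical_set_scope.
Open Scope ring_scope.

(* Lebesgue measure on (0, L), as a measure on the whole line that ignores
   everything outside of (0, L). *)
Definition mu0 (R : realType) (L : R) :
    {measure set (measurableTypeR R) -> \bar R} :=
  mrestr lebesgue_measure (measurable_itv `]0, L[).

(* Real L^2(0, L): classes of functions modulo equality a.e. on (0, L). An
   element coerces to a representative R -> R, and the library has no algebraic
   structure on this type, so identities between elements are written below as
   a.e. identities between representatives. *)
Definition L2 (R : realType) (L : R) : Type := LspaceType2 (mu0 L).

HB.instance Definition _ (R : realType) (L : R) := gen_eqMixin (L2 L).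
HB.instance Definition _ (R : realType) (L : R) := gen_choiceMixin (L2 L).

Definition L2fun (R : realType) (L : R) (f : L2 L) : R -> R :=
  (f : LspaceType2 (mu0 L)).
Coercion L2fun : L2 >-> Funclass.

Section L2space.
Context {R : realType} {L : R}.
Implicit Types (F E : set (L2 L)) (x y z : L2 L).

Definition L2norm (f : R -> R) : \bar R := 'N[mu0 L]_2%:E[EFin \o f]%E.

Definition L2dot (f g : R -> R) : R := (\int[mu0 L]_t (f t * g t))%R.

Definition L2orth E : set (L2 L) :=
  [set z | forall y, E y -> L2dot z y = 0].

Definition L2span n (g : 'I_n -> R -> R) : set (L2 L) :=
  [set y | exists a : 'I_n -> R,
     y = (fun t => \sum_(i < n) a i * g i t) %[ae mu0 L]].

Definition closed_subspace F : Prop :=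
  [/\ forall z, z = cst 0 %[ae mu0 L] -> F z,
      forall (a : R) x y z, F x -> F y ->
        z = (fun t => a * x t + y t) %[ae mu0 L] -> F z &
      forall (u : nat -> L2 L) x, (forall n, F (u n)) ->
        L2norm (u n \- x) @[n --> \oo] --> 0%E -> F x].

Definition decomposes F E x y z : Prop :=
  [/\ F y, E z & x = y \+ z %[ae mu0 L]].

Definition direct_sum F E : Prop :=
  [/\ closed_subspace F, closed_subspace E &
      forall x, exists! yz : L2 L * L2 L, decomposes F E x yz.1 yz.2].

(* The projection onto F along E; the default value x is only taken when x has
   no decomposition, hence never when direct_sum F E holds. *)
Definition oblique_proj F E (x : L2 L) : L2 L :=
  xget x [set y | exists z, decomposes F E x y z].

(* Extended-real valued: +oo for an unbounded operator. *)
Definition opnorm (P : L2 L -> L2 L) : \bar R :=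
  ereal_sup [set L2norm (P x) | x in [set x : L2 L | (L2norm x <= 1)%E]].

End L2space.

Arguments L2norm {R} L f.
Arguments L2dot {R} L f g.

Section Neumann.
Context {R : realType}.

(* phi is an eigenfunction of - d^2/dx^2 on (0, L) for the eigenvalue lam; the
   boundary conditions are one-sided limits because phi is only relevant on
   (0, L). *)
Definition neumann_eigenfunction (L lam : R) (phi : R -> R) : Prop :=
  [/\ forall x : R, x \in `]0, L[ ->
        [/\ derivable phi x 1, derivable (derive1 phi) x 1 &
            - derive1n 2 phi x = lam * phi x],
      derive1 phi x @[x --> 0^'+] --> (0 : R),
      derive1 phi x @[x --> L^'-] --> (0 : R) &
      exists2 x : R, x \in `]0, L[ & phi x != 0].

(* e i is the (i+1)-st Neumann eigenfunction, with eigenvalue lam i. All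
   eigenvalues are simple, so strict monotonicity loses nothing. *)
Definition neumann_eigensystem (L : R) (lam : nat -> R) (e : nat -> R -> R) :
    Prop :=
  [/\ forall i, neumann_eigenfunction L (lam i) (e i),
      forall i j, (i < j)%N -> lam i < lam j &
      forall (l : R) phi, neumann_eigenfunction L l phi ->
        exists i, l = lam i].

Definition eigen_span (L : R) (e : nat -> R -> R) (M : nat) : set (L2 L) :=
  L2span (fun i : 'I_M => e i).

End Neumann.
Arguments eigen_span {R} L e M.

Section Actuators.
Context {R : realType}.
Implicit Types (L r : R) (M j : nat).

Definition center L M j : R := (2 * j%:R - 1) * L / (2 * M%:R).

Definition actuator_domain L r M j : set R :=
  `]center L M j - r * L / (2 * M%:R), center L M j + r * L / (2 * M%:R)[.

(* center and actuator_domain are indexed from 1, ordinals from 0. *)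
Definition actuator_span L r M : set (L2 L) :=
  L2span (fun j : 'I_M => \1_(actuator_domain L r M j.+1)).

End Actuators.
Arguments actuator_span {R} L r M.

(* Main.v *)
(** On the span of the actuators, [|sum_j a_j 1_(omega_j)|^2 = (rL/M) |a|^2],
    and the inner product of [1_(omega_j)] with [cos(i pi x/L)] factors as
    [s_i v_ij], where [s_i = (rL/M) sinc(i pi r/(2M))] and
    [v_ij = cos(i pi (2j-1)/(2M))].  The rows of [v] are orthogonal (discrete
    cosine transform), hence so are its columns after weighting, and the
    orthogonal projection onto the cosines acts diagonally on the actuator
    space.  Inverting it gives
    [|P x|^2 = sum_i (r sinc(i pi r/(2M))^2)^-1 <x, cos_i>^2/|cos_i|^2], so
    Bessel's inequality and the monotonicity of [sinc] on [[0, pi/2]] yield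
    [|P| = (sqrt r * sinc((M-1) pi r/(2M)))^-1], attained at the last cosine. *)

(* The eigensystem is arbitrary and known only through its differential equation, so that [E_M] is a
   span of cosines has to be derived: variation of constants solves the equation, and the ordering
   of the eigenvalues matches indices with frequencies. The linear algebra uses nothing but Gram
   relations, collected as the hypotheses of section [Oblique]. There are as many actuators as
   eigenfunctions, so the matrix [v] is square; this turns orthogonality of its rows into weighted
   orthogonality of its columns, which gives both existence and uniqueness of the decomposition. The
   constant mode is exceptional twice: its squared norm in [L^2(0, L)] and its squared row norm in
   [v] are each double those of the other modes. The two factors cancel, so that the gain of every
   mode depends on [sinc] alone. *)
From HB Require Import structures.
Require Import Defs.
From mathcomp Require Import measurable_realfun.
From mathcomp Require Import ring lra zify.

Set Implicit Arguments.
Unset Strict Implicit.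

(** * Inner products of square-integrable functions *)

Section Lspace2.
Context d (T : measurableType d) (R : realType).
Variable mu : {measure set T -> \bar R}.
Implicit Types (f g h : T -> R) (x y z : LspaceType2 mu).
Local Notation sq := (Lfun mu 2%:E).
Local Notation dot f g := (\int[mu]_t (f t * g t))%R.

Lemma Lfun_measurable f : f \in sq -> measurable_fun setT f.
Proof. by move=> /[!inE] /andP[/[!inE]]. Qed.

Lemma LspaceType2_Lfun x : (x : T -> R) \in sq.
Proof.
rewrite inE; apply/andP; split; rewrite inE /=.
  by have := @measurable_funPT _ _ _ _ (repr (LebesgueSpace.sort x)).
exact: Lebesgue_finite.
Qed.

(** The quotient already identifies functions equal a.e.; what is left is the packed proof of finite
    norm, unique by proof irrelevance. Uniqueness in [direct_sum] is Leibniz equality and rests on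
    this. *)
Lemma LspaceType2_ae_inj x y : (x : T -> R) = (y : T -> R) %[ae mu] -> x = y.
Proof.
case: x => x [[xP]]; case: y => y [[yP]] /= xy.
have e : x = y.
  rewrite -[x]reprK -[y]reprK; apply/eqmodP.
  by apply/asboolP.
by subst y; rewrite (Prop_irrelevance xP yP).
Qed.

Lemma ae_eq_Lnorm2 f g : measurable_fun setT f -> measurable_fun setT g ->
  f = g %[ae mu] -> ('N[mu]_2%:E[EFin \o f] = 'N[mu]_2%:E[EFin \o g])%E.
Proof.
move=> mf mg fg.
have mp h : measurable_fun setT h ->
    measurable_fun setT (fun t => `|(EFin \o h) t| `^ 2)%E.
  move=> mh.
  apply: (measurableT_comp (@measurable_poweR R 2)).
  by apply: measurableT_comp => //; apply/measurable_EFinP.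
rewrite unlock; congr (_ `^ _)%E; apply: ge0_ae_eq_integral => //.
- exact: mp.
- exact: mp.
- by move=> t _; exact: poweR_ge0.
- by move=> t _; exact: poweR_ge0.
by apply: filterS fg => t e _; rewrite /= e.
Qed.

(** Vectors are built below as explicit functions; this provides their classes. *)
Lemma LspaceType2_surj f : f \in sq -> exists x, (x : T -> R) = f %[ae mu].
Proof.
move=> fsq; have mf := Lfun_measurable fsq.
have mf' : measurable_fun setT (f : T -> measurableTypeR R) by [].
pose G : {mfun T >-> measurableTypeR R} :=
  HB.pack f (isMeasurableFun.Build _ _ T (measurableTypeR R) f mf').
pose q : aeEqMfun (measurableTypeR R) mu :=
  (\pi_(aeEqMfun (measurableTypeR R) mu) G)%qT.
have qf : (repr q : _ -> _) = f %[ae mu].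
  have : (repr q = G %[mod aeEqMfun (measurableTypeR R) mu])%qT.
    by rewrite reprK.
  by move=> /eqmodP/asboolP.
have mq : measurable_fun setT (repr q : T -> R).
  by have := @measurable_funPT _ _ _ _ (repr q).
have qfin : finite_norm mu 2%:E q.
  move: fsq => /[!inE] /andP[_ /[!inE]/=]; rewrite /finite_norm.
  by rewrite (ae_eq_Lnorm2 mf mq)//; exact: ae_eq_sym.
exists (LebesgueSpace.Pack (LebesgueSpace.Class
  (isFinLebesgue.Build _ _ _ mu _ (lee1n 2) q qfin))).
exact: qf.
Qed.

Lemma Lfun2D f g : f \in sq -> g \in sq -> (fun t => f t + g t) \in sq.
Proof.
by have [_ hD] := @Lfun_addr_closed _ _ _ mu _ (lee1n 2); exact: hD.
Qed.

Lemma Lfun2Z a f : f \in sq -> (fun t => a * f t) \in sq.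
Proof.
move=> fs; have -> : (fun t => a * f t) = a \o* f.
  by apply/funext => t /=; rewrite mulrC.
by apply: Lfun_scale => //; rewrite ler1n.
Qed.

Lemma Lfun2B f g : f \in sq -> g \in sq -> (f \- g) \in sq.
Proof.
move=> fs gs; have -> : f \- g = (fun t => f t + (-1) * g t).
  by apply/funext => t /=; rewrite mulN1r.
exact/Lfun2D/Lfun2Z.
Qed.

Lemma Lfun2_0 : cst 0 \in sq.
Proof. by have [h _] := @Lfun_addr_closed _ _ _ mu _ (lee1n 2). Qed.

Lemma Lfun2_sum n (a : 'I_n -> R) (g : 'I_n -> T -> R) :
  (forall i, g i \in sq) -> (fun t => \sum_(i < n) a i * g i t) \in sq.
Proof.
move=> gs; elim: n => [|n IH] in a g gs *.
  under eq_fun do rewrite big_ord0; exact: Lfun2_0.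
under eq_fun do rewrite big_ord_recr /=.
have gs' i : g (widen_ord (leqnSn n) i) \in sq by [].
apply: Lfun2D; last exact: Lfun2Z.
exact: (IH (fun i => a (widen_ord (leqnSn n) i)) _ gs').
Qed.

Lemma Lfun2_mul_integrable f g : f \in sq -> g \in sq ->
  mu.-integrable setT (EFin \o (fun t => f t * g t)).
Proof. by move=> fs gs; apply/Lfun1_integrable/Lfun2_mul_Lfun1. Qed.

Lemma dotC f g : dot f g = dot g f.
Proof. by apply: eq_Rintegral => t _; rewrite mulrC. Qed.

Lemma dotDl f g h : f \in sq -> g \in sq -> h \in sq ->
  dot (fun t => f t + g t) h = dot f h + dot g h.
Proof.
move=> fs gs hs; rewrite -RintegralD//; try exact: Lfun2_mul_integrable.
by apply: eq_Rintegral => t _; rewrite mulrDl.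
Qed.

Lemma dotZl a f h : f \in sq -> h \in sq ->
  dot (fun t => a * f t) h = a * dot f h.
Proof.
move=> fs hs; rewrite -RintegralZl//; try exact: Lfun2_mul_integrable.
by apply: eq_Rintegral => t _; rewrite mulrA.
Qed.

Lemma dotBl f g h : f \in sq -> g \in sq -> h \in sq ->
  dot (f \- g) h = dot f h - dot g h.
Proof.
move=> fs gs hs; rewrite -RintegralB//; try exact: Lfun2_mul_integrable.
by apply: eq_Rintegral => t _; rewrite mulrBl.
Qed.

Lemma dot0l h : dot (cst 0) h = 0.
Proof.
by under eq_Rintegral do rewrite mul0r; rewrite Rintegral_cst// mul0r.
Qed.

Lemma dot_suml n (a : 'I_n -> R) (g : 'I_n -> T -> R) h :
  (forall i, g i \in sq) -> h \in sq ->
  dot (fun t => \sum_(i < n) a i * g i t) h = \sum_(i < n) a i * dot (g i) h.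
Proof.
move=> gs hs; elim: n => [|n IH] in a g gs *.
  under eq_Rintegral do rewrite big_ord0 mul0r.
  by rewrite big_ord0 Rintegral_cst// mul0r.
under eq_Rintegral do rewrite big_ord_recr /=.
rewrite dotDl ?dotZl ?IH//; first by rewrite big_ord_recr.
- have gs' i : g (widen_ord (leqnSn n) i) \in sq by [].
  exact: (Lfun2_sum (fun i => a (widen_ord (leqnSn n) i)) gs').
- exact: Lfun2Z.
Qed.

Lemma dot_ge0 f : 0 <= dot f f.
Proof. by apply: Rintegral_ge0 => t _; rewrite -expr2 sqr_ge0. Qed.

Lemma ae_eq_dotl f g h : f \in sq -> g \in sq -> h \in sq ->
  f = g %[ae mu] -> dot f h = dot g h.
Proof.
move=> fs gs hs fg; congr fine; apply: ae_eq_integral => //.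
- by have /integrableP[] := Lfun2_mul_integrable fs hs.
- by have /integrableP[] := Lfun2_mul_integrable gs hs.
by apply: filterS fg => t /= e _; rewrite e.
Qed.

Lemma Lnorm2E f : f \in sq ->
  'N[mu]_2%:E[EFin \o f]%E = (Num.sqrt (dot f f))%:E.
Proof.
move=> fs; rewrite unlock.
have -> : (\int[mu]_x (`|(EFin \o f) x| `^ 2))%E = (dot f f)%:E.
  rewrite /Rintegral fineK; last exact/integrable_fin_num/Lfun2_mul_integrable.
  apply: eq_integral => t _ /=.
  by rewrite /= powR_mulrn// -normrX ger0_norm ?sqr_ge0// expr2.
by rewrite poweR_EFin powR12_sqrt// dot_ge0.
Qed.

Lemma dot_eq0 f : f \in sq -> dot f f = 0 -> f = cst 0 %[ae mu].
Proof.
move=> fs ff0.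
have mf := Lfun_measurable fs.
have : (EFin \o f) = \0 %[ae mu].
  apply: (@Lnorm_eq0_eq0 _ _ _ _ _ 2%:E) => //; first exact/measurable_EFinP.
  by rewrite Lnorm2E// ff0 sqrtr0.
by apply: filterS => t /= /(_ I) [].
Qed.

End Lspace2.

(** * Cauchy-Schwarz and orthogonal complements in L^2(0, L) *)

Section L2geometry.
Context {R : realType} {L : R}.
Implicit Types (f g h : R -> R) (E : set (L2 L)) (x y z : L2 L).
Local Notation mu := (mu0 L).
Local Notation dot := (L2dot L).
Local Notation sq := (Lfun mu 2%:E).

Lemma L2_Lfun x : (x : R -> R) \in sq.
Proof. exact: LspaceType2_Lfun. Qed.
Local Hint Resolve L2_Lfun : core.

(* Integrals against [mu0 L] restated for [L2dot], which [rewrite] does not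
   unfold. *)
Lemma L2dotC f g : dot f g = dot g f. Proof. exact: dotC. Qed.

Lemma L2dotDl f g h : f \in sq -> g \in sq -> h \in sq ->
  dot (fun t => f t + g t) h = dot f h + dot g h.
Proof. exact: dotDl. Qed.

Lemma L2dotZl a f h : f \in sq -> h \in sq ->
  dot (fun t => a * f t) h = a * dot f h.
Proof. exact: dotZl. Qed.

Lemma L2dotBl f g h : f \in sq -> g \in sq -> h \in sq ->
  dot (f \- g) h = dot f h - dot g h.
Proof. exact: dotBl. Qed.

Lemma L2dot0l f : dot (cst 0) f = 0. Proof. exact: dot0l. Qed.

Lemma L2dot_ge0 f : 0 <= dot f f. Proof. exact: dot_ge0. Qed.

Lemma L2dot_suml n (a : 'I_n -> R) (g : 'I_n -> R -> R) h :
  (forall i, g i \in sq) -> h \in sq ->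
  dot (fun t => \sum_(i < n) a i * g i t) h = \sum_(i < n) a i * dot (g i) h.
Proof. exact: dot_suml. Qed.

Lemma ae_eq_L2dotl f g h : f \in sq -> g \in sq -> h \in sq ->
  f = g %[ae mu] -> dot f h = dot g h.
Proof. exact: ae_eq_dotl. Qed.

(** Nonnegativity of this quadratic in [a] yields both Cauchy-Schwarz and, with [a = -1], Bessel's
    inequality. *)
Lemma L2dot_sqrD a f g : f \in sq -> g \in sq ->
  dot (fun t => f t + a * g t) (fun t => f t + a * g t) =
  dot f f + 2 * a * dot f g + a ^+ 2 * dot g g.
Proof.
move=> fs gs; have ags := Lfun2Z a gs; have fags := Lfun2D fs ags.
rewrite L2dotDl// L2dotZl// ![dot _ (fun t => f t + _)]L2dotC.
rewrite !L2dotDl// !L2dotZl//.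
by rewrite [dot g f]L2dotC; ring.
Qed.

Lemma L2_cauchy_schwarz f g : f \in sq -> g \in sq ->
  dot f g ^+ 2 <= dot f f * dot g g.
Proof.
move=> fs gs.
have key a : 0 <= dot f f + 2 * a * dot f g + a ^+ 2 * dot g g.
  by rewrite -L2dot_sqrD// L2dot_ge0.
have [gg0|gg0] := eqVneq (dot g g) 0.
  have [->|fg0] := eqVneq (dot f g) 0; first by rewrite gg0 mulr0 expr0n.
  have := key (- (dot f f + 1) / (2 * dot f g)); rewrite gg0 mulr0 addr0.
  (* With [dot g g = 0] the expression is affine in [a], and the chosen [a] makes it equal to -1, a
     contradiction. *)
  rewrite [X in 0 <= X](_ : _ = - 1) ?oppr_ge0 ?ler10//; by field.
have gp : 0 < dot g g by rewrite lt0r gg0 L2dot_ge0.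
(* The minimizer of the quadratic. *)
have := key (- dot f g / dot g g).
rewrite [X in 0 <= X](_ : _ = dot f f - dot f g ^+ 2 / dot g g); last by field.
by rewrite subr_ge0 ler_pdivrMr.
Qed.

Lemma L2normE f : f \in sq -> L2norm L f = (Num.sqrt (dot f f))%:E.
Proof. exact: Lnorm2E. Qed.

Lemma closed_subspace_orth E : closed_subspace (L2orth E).
Proof.
split.
- move=> z z0 y Ey; have s0 : cst 0 \in sq := Lfun2_0 _.
  by rewrite (ae_eq_L2dotl _ _ _ z0)// L2dot0l.
- move=> a x y z Ex Ey zE w Ew.
  have axs := Lfun2Z a (L2_Lfun x).
  have zs : (fun t => a * x t + y t) \in sq by exact: Lfun2D.
  rewrite (ae_eq_L2dotl _ _ _ zE)// L2dotDl// L2dotZl//.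
  by rewrite Ex// Ey// mulr0 addr0.
move=> u x Eu ux y Ey.
have sb n : (u n \- x) \in sq by exact: Lfun2B.
pose s n := Num.sqrt (dot (u n \- x) (u n \- x)).
have s0 : s n @[n --> \oo] --> (0 : R).
  have -> : s = fine \o (fun n => L2norm L (u n \- x)).
    by apply/funext => n /=; rewrite L2normE.
  by have /fine_cvgP[] := ux.
(* As [u n] is orthogonal to [y], only the error [u n \- x] contributes to the product of [x] and
   [y]. *)
have key n : dot x y ^+ 2 <= s n ^+ 2 * dot y y.
  rewrite sqr_sqrtr ?L2dot_ge0//.
  have -> : dot x y = - dot (u n \- x) y.
    by rewrite L2dotBl// Eu// sub0r opprK.
  by rewrite sqrrN L2_cauchy_schwarz.
have lim0 : s n ^+ 2 * dot y y @[n --> \oo] --> 0 * 0 * dot y y.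
  by apply: cvgMr_tmp; exact: (cvgM s0 s0).
move: lim0; rewrite !mul0r => lim0.
have : dot x y ^+ 2 <= 0.
  by apply: (ler_cvg_to (cvg_cst _) lim0); apply: nearW.
by move=> h; apply/eqP; rewrite -sqrf_eq0 eq_le h sqr_ge0.
Qed.

End L2geometry.

#[local] Instance mu0_ae_filter (R : realType) (L : R) :
  Filter (nbhs (almost_everywhere (mu0 L))) := ae_filter_ringOfSetsType (mu0 L).

(** * Spans of finitely many functions *)

Section Spans.
Context {R : realType} {L : R}.
Implicit Types (f g h : R -> R) (E : set (L2 L)) (x y z : L2 L).
Local Notation mu := (mu0 L).
Local Notation dot := (L2dot L).
Local Notation sq := (Lfun mu 2%:E).
Local Hint Resolve L2_Lfun : core.

Lemma L2_surj f : f \in sq -> exists x : L2 L, x = f %[ae mu].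
Proof. exact: LspaceType2_surj. Qed.

Lemma L2_ae_inj x y : x = y %[ae mu] -> x = y.
Proof. exact: LspaceType2_ae_inj. Qed.

Lemma L2_sum n (a : 'I_n -> R) (g : 'I_n -> R -> R) :
  (forall i, g i \in sq) -> (fun t => \sum_(i < n) a i * g i t) \in sq.
Proof. exact: Lfun2_sum. Qed.

Lemma L2orth_spanP n (g : 'I_n -> R -> R) z : (forall i, g i \in sq) ->
  L2orth (L2span g) z <-> forall i, dot z (g i) = 0.
Proof.
move=> gs; split=> [zg i|zg y [a yE]].
  (* [L2orth] tests against classes only, hence against a class of [g i], which lies in the span
     with Kronecker coefficients. *)
  have [y yE] := L2_surj (gs i).
  rewrite L2dotC -(ae_eq_L2dotl _ _ _ yE)// L2dotC; apply: zg.
  exists (fun j => (j == i)%:R); apply: filterS yE => t yE ?; rewrite yE//.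
  rewrite (bigD1 i)//= eqxx mul1r big1 ?addr0// => j /negPf ->.
  by rewrite mul0r.
have ys := L2_sum a gs.
rewrite L2dotC (ae_eq_L2dotl _ _ _ yE)// L2dot_suml// big1// => i _.
by rewrite L2dotC zg mulr0.
Qed.

Section Orthogonal.
Variables (n : nat) (g : 'I_n -> R -> R) (N : 'I_n -> R).
Hypotheses (gs : forall i, g i \in sq) (N0 : forall i, 0 < N i)
  (gg : forall i j, dot (g i) (g j) = (i == j)%:R * N i).

Lemma L2dot_orth_suml (a : 'I_n -> R) j :
  dot (fun t => \sum_(i < n) a i * g i t) (g j) = a j * N j.
Proof.
rewrite L2dot_suml// (bigD1 j)//= gg eqxx mul1r big1 ?addr0// => i /negPf ij.
by rewrite gg ij mul0r mulr0.
Qed.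

Lemma L2dot_orth_sum (a b : 'I_n -> R) :
  dot (fun t => \sum_(i < n) a i * g i t) (fun t => \sum_(i < n) b i * g i t) =
  \sum_(i < n) a i * b i * N i.
Proof.
rewrite L2dot_suml//; last exact: L2_sum.
by apply: eq_bigr => i _; rewrite L2dotC L2dot_orth_suml mulrA.
Qed.

Lemma L2_bessel f : f \in sq -> \sum_(i < n) dot f (g i) ^+ 2 / N i <= dot f f.
Proof.
move=> fs; pose b i := dot f (g i) / N i.
have bs := L2_sum b gs.
(* The squared norm of [f] minus its projection onto the span. *)
have := L2dot_ge0 (L := L) (fun t => f t + (-1) * \sum_(i < n) b i * g i t).
rewrite L2dot_sqrD// L2dot_orth_sum L2dotC L2dot_suml//.
under eq_bigr => i _ do rewrite [dot (g i) f]L2dotC.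
have e1 : \sum_(i < n) b i * dot f (g i) = \sum_(i < n) dot f (g i) ^+ 2 / N i.
  by apply: eq_bigr => i _; rewrite /b mulrAC expr2.
have e2 : \sum_(i < n) b i * b i * N i = \sum_(i < n) dot f (g i) ^+ 2 / N i.
  by apply: eq_bigr => i _; rewrite /b; field; rewrite gt_eqF.
rewrite e1 e2; lra.
Qed.

(** Exhibits the span as an orthogonal complement, so that its closedness follows from
    [closed_subspace_orth]. *)
Lemma L2orth_orth_span : L2orth (L2orth (L2span g : set (L2 L))) = L2span g.
Proof.
apply/seteqP; split=> [x xP|x xg z zg]; last by rewrite L2dotC zg.
pose b i := dot x (g i) / N i; exists b.
have bs := L2_sum b gs.
have ds := Lfun2B (L2_Lfun x) bs.
have [z zE] := L2_surj ds.
have zg i : dot z (g i) = 0.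
  rewrite (ae_eq_L2dotl _ _ _ zE)// L2dotBl// L2dot_orth_suml /b divfK ?subrr//.
  by rewrite gt_eqF.
(* The remainder [z] of [x] is orthogonal to the span, hence to [x] by assumption on [x], hence to
   their difference, which is [z] itself. *)
have zz : dot z z = 0.
  rewrite {1}(ae_eq_L2dotl _ _ _ zE)// L2dotBl// xP; last exact/L2orth_spanP.
  rewrite sub0r L2dot_suml// big1 ?oppr0// => i _.
  by rewrite L2dotC zg mulr0.
have := dot_eq0 (L2_Lfun z) zz.
apply: filterS2 zE => t zE z0 _; have := zE I; rewrite z0//= => /esym/eqP.
by rewrite subr_eq0 => /eqP.
Qed.

Lemma closed_subspace_span : closed_subspace (L2span g : set (L2 L)).
Proof. by rewrite -L2orth_orth_span; exact: closed_subspace_orth. Qed.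

End Orthogonal.

End Spans.

(** * The oblique projection computed from Gram relations *)

Section Oblique.
Context {R : realType} {L : R}.
Local Notation mu := (mu0 L).
Local Notation dot := (L2dot L).
Local Notation sq := (Lfun mu 2%:E).
Local Hint Resolve L2_Lfun : core.
(** In the application [u] are the actuators, [c] the cosines and [v] the cosines sampled at the
    centers. [w], [N] and [d] are the squared norms of the [u j], the [c i] and the rows of [v]. *)
Variables (n : nat) (u c : 'I_n -> R -> R) (w : R) (N s d : 'I_n -> R)
  (v : 'I_n -> 'I_n -> R).
Hypotheses (us : forall j, u j \in sq) (cs : forall i, c i \in sq)
  (w0 : 0 < w) (N0 : forall i, 0 < N i) (s0 : forall i, 0 < s i)
  (d0 : forall i, 0 < d i).
Hypotheses (uu : forall j k, dot (u j) (u k) = (j == k)%:R * w)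
  (cc : forall i k, dot (c i) (c k) = (i == k)%:R * N i)
  (uc : forall i j, dot (u j) (c i) = s i * v i j)
  (vv : forall i k, \sum_(j < n) v i j * v k j = (i == k)%:R * d i).
Implicit Types x y z : L2 L.
Let U := L2span u : set (L2 L).
Let E := L2orth (L2span c) : set (L2 L).

(** [vv] says that [W] is a right inverse of the square matrix [V]; it is therefore a left inverse
    too. *)
Lemma dual_orthogonality j k : \sum_(i < n) v i j * v i k / d i = (j == k)%:R.
Proof.
pose V := \matrix_(i, j) v i j.
pose W := \matrix_(j, i) (v i j / d i).
have /mulmx1C/matrixP/(_ j k) : V *m W = 1%:M.
  apply/matrixP => i k'; rewrite !mxE.
  under eq_bigr do rewrite !mxE mulrA.
  rewrite -mulr_suml vv; have [->|_] := eqVneq i k'; last by rewrite !mul0r.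
  by rewrite mul1r mulfV// gt_eqF.
rewrite !mxE => <-; apply: eq_bigr => i _; rewrite !mxE; ring.
Qed.

Lemma dot_decomp (a : 'I_n -> R) x y z i :
  y = (fun t => \sum_(j < n) a j * u j t) %[ae mu] -> decomposes U E x y z ->
  dot x (c i) = s i * \sum_(j < n) v i j * a j.
Proof.
move=> yE [_ /(L2orth_spanP _ cs) zc xE].
have as_ := L2_sum a us.
have yzs : y \+ z \in sq by exact: (Lfun2D (L2_Lfun y) (L2_Lfun z)).
rewrite (ae_eq_L2dotl _ _ _ xE)// L2dotDl// zc addr0 (ae_eq_L2dotl _ _ _ yE)//.
rewrite L2dot_suml// mulr_sumr; apply: eq_bigr => j _; rewrite uc; ring.
Qed.

(** Inverts the linear system of [dot_decomp] by [dual_orthogonality]. The coefficients depend on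
    [x] alone, whence uniqueness; the same formula is the witness for existence. *)
Lemma coef_decomp (a : 'I_n -> R) x y z j :
  y = (fun t => \sum_(j < n) a j * u j t) %[ae mu] -> decomposes U E x y z ->
  a j = \sum_(i < n) v i j * dot x (c i) / (s i * d i).
Proof.
move=> yE xyz.
under eq_bigr => i _.
  rewrite (dot_decomp i yE xyz).
  have -> : v i j * (s i * \sum_(j < n) v i j * a j) / (s i * d i) =
    \sum_(k < n) (v i j * v i k / d i) * a k.
    rewrite mulr_sumr mulr_sumr mulr_suml; apply: eq_bigr => k _.
    by field; rewrite !gt_eqF.
  over.
rewrite exchange_big /=; under eq_bigr do rewrite -mulr_suml dual_orthogonality.
rewrite (bigD1 j)//= eqxx mul1r big1 ?addr0// => k /negPf kj.
by rewrite eq_sym kj mul0r.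
Qed.

Lemma oblique_direct_sum : direct_sum U E.
Proof.
split=> [||x].
- exact: (closed_subspace_span us (fun=> w0) uu).
- exact: closed_subspace_orth.
(* The only candidate, by [coef_decomp]. *)
pose a j := \sum_(i < n) v i j * dot x (c i) / (s i * d i).
have as_ := L2_sum a us.
have [y yE] := L2_surj as_.
have xys : (x \- y) \in sq by exact: (Lfun2B (L2_Lfun x) (L2_Lfun y)).
have [z zE] := L2_surj xys.
have xyz : decomposes U E x y z.
  split; first by exists a.
    apply/(L2orth_spanP _ cs) => i.
    rewrite (ae_eq_L2dotl _ _ _ zE)// L2dotBl// (ae_eq_L2dotl _ _ _ yE)//.
    rewrite L2dot_suml//.
    under eq_bigr => j _ do rewrite uc /a mulr_suml.
    rewrite exchange_big /=.
    under eq_bigr => k _.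
      have -> : \sum_(j < n) v k j * dot x (c k) / (s k * d k) * (s i * v i j) =
         dot x (c k) / (s k * d k) * s i * \sum_(j < n) v k j * v i j.
        by rewrite mulr_sumr; apply: eq_bigr => j _; ring.
      rewrite vv; over.
    rewrite (bigD1 i)//= eqxx big1 ?addr0.
      by rewrite mul1r; field; rewrite !gt_eqF.
    by move=> k /negPf ->; rewrite mul0r mulr0.
  by apply: filterS zE => t zE ?; rewrite /= zE//= addrC subrK.
exists (y, z); split=> // -[y' z'] /= xyz'.
have [[b bE] _ xE'] := xyz'.
have yy' : y = y' %[ae mu].
  apply: filterS2 (yE) (bE) => t yt bt ?; rewrite yt// bt//.
  by apply: eq_bigr => j _; rewrite (coef_decomp j bE xyz').
have [_ _ xE] := xyz.
congr (_, _); apply: L2_ae_inj => //.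
apply: filterS3 xE xE' yy' => t xE xE' yy' ?.
(* Since [y] and [y'] agree a.e., so do the remainders [z] and [z']. *)
by have := xE' I; rewrite xE//= yy'// => /addrI.
Qed.

Lemma oblique_norm x y z : decomposes U E x y z ->
  dot y y = \sum_(i < n) w / (s i ^+ 2 * d i) * dot x (c i) ^+ 2.
Proof.
move=> xyz; have [[a yE] _ _] := xyz.
have as_ := L2_sum a us.
rewrite (ae_eq_L2dotl _ _ _ yE)// L2dotC (ae_eq_L2dotl _ _ _ yE)//.
rewrite (L2dot_orth_sum us uu).
(* Only one of the two factors [a j] is expanded; the sum over [j] of the other against [v i j] is
   again a product of [x] with [c i], by [dot_decomp]. *)
under eq_bigr => j _ do rewrite {1}(coef_decomp j yE xyz) !mulr_suml.
rewrite exchange_big /=; apply: eq_bigr => i _.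
have -> : w / (s i ^+ 2 * d i) * dot x (c i) ^+ 2 =
  w / (s i ^+ 2 * d i) * dot x (c i) * (s i * \sum_(j < n) v i j * a j).
  by rewrite -(dot_decomp i yE xyz); ring.
rewrite !mulr_sumr; apply: eq_bigr => j _; by field; rewrite !gt_eqF.
Qed.

Lemma oblique_projP x : exists z, decomposes U E x (oblique_proj U E x) z.
Proof.
have [_ _ /(_ x)[[y z] [xyz _]]] := oblique_direct_sum.
rewrite /oblique_proj; case: xgetP => [y' -> //|/(_ y)[]].
by exists z.
Qed.

Lemma oblique_opnorm i0 :
  (forall i, w * N i / (s i ^+ 2 * d i) <= w * N i0 / (s i0 ^+ 2 * d i0)) ->
  opnorm (oblique_proj U E) = (Num.sqrt (w * N i0 / (s i0 ^+ 2 * d i0)))%:E.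
Proof.
set K := w * N i0 / _ => Kmax.
have K0 : 0 < K by rewrite /K !divr_gt0 ?mulr_gt0 ?exprn_gt0.
have nE x := L2normE (L2_Lfun x).
apply/eqP; rewrite eq_le; apply/andP; split.
  apply: ub_ereal_sup => _ [x /= x1 <-].
  have [z /oblique_norm PxE] := oblique_projP x.
  rewrite nE PxE lee_fin ler_wsqrtr//.
  move: x1; rewrite nE lee_fin -[leRHS]sqrtr1 ler_sqrt// => x1.
  apply: (@le_trans _ _ (K * dot x x)); last by rewrite ger_pMr.
  apply: le_trans (ler_wpM2l (ltW K0) (L2_bessel cs N0 cc (L2_Lfun x))).
  rewrite mulr_sumr; apply: ler_sum => i _.
  have -> : w / (s i ^+ 2 * d i) * dot x (c i) ^+ 2 =
     w * N i / (s i ^+ 2 * d i) * (dot x (c i) ^+ 2 / N i).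
    by field; rewrite !gt_eqF.
  by rewrite ler_wpM2r// divr_ge0 ?sqr_ge0// ltW.
(* Scales [c i0] to a unit vector; its products with the other [c i] vanish, so the upper bound is
   attained there. *)
pose b := (Num.sqrt (N i0))^-1.
have b2 : b ^+ 2 * N i0 = 1.
  by rewrite /b exprVn sqr_sqrtr ?mulVf ?gt_eqF// ltW.
have bs := Lfun2Z b (cs i0).
have [x xE] := L2_surj bs.
have xc i : dot x (c i) = (i == i0)%:R * (b * N i0).
  by rewrite (ae_eq_L2dotl _ _ _ xE)// L2dotZl// cc [i0 == i]eq_sym mulrCA.
apply: ereal_sup_ge; exists (L2norm L (oblique_proj U E x)).
  exists x => //=; rewrite nE lee_fin (ae_eq_L2dotl _ _ _ xE)// L2dotZl//.
  rewrite L2dotC xc.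
  by rewrite eqxx mul1r mulrA -expr2 b2 sqrtr1.
have [z /oblique_norm PxE] := oblique_projP x.
rewrite nE PxE lee_fin ler_wsqrtr//.
rewrite (bigD1 i0)//= xc eqxx mul1r big1 ?addr0 => [|i /negPf ii0].
  by rewrite -[leLHS]mulr1 -b2 /K le_eqVlt; apply/orP; left; apply/eqP; ring.
by rewrite xc ii0 mul0r expr0n mulr0.
Qed.

End Oblique.

(** * Neumann eigenfunctions *)

Section ODE.
Context {R : realType}.
Implicit Types (f g F phi : R -> R) (a b k l L lam x y : R).

Lemma is_derive_0_itv_cst f a b :
  (forall x, x \in `]a, b[ -> is_derive x 1 f 0) ->
  {in `]a, b[ &, forall x y, f x = f y}.
Proof.
move=> df x y xab yab.
wlog xy : x y xab yab / x <= y.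
  by move=> H; have [/H|/ltW/H] := leP x y => ->.
have sub z : z \in `[x, y] -> z \in `]a, b[.
  move: xab yab; rewrite !in_itv /= => /andP[ax _] /andP[_ yb] /andP[xz zy].
  by rewrite (lt_le_trans ax xz) (le_lt_trans zy yb).
apply/eqP; rewrite eq_sym -subr_eq0; apply/eqP.
have dxy z : z \in `]x, y[ -> is_derive z 1 f 0.
  by move=> zxy; apply/df/sub; apply: subset_itv_oo_cc zxy.
have cxy : {within `[x, y], continuous f}.
  apply: derivable_within_continuous => z zxy.
  by have [] := df _ (sub _ zxy).
have [c _ e] := MVT_segment xy dxy cxy.
by rewrite e mul0r.
Qed.

Lemma is_derive_mulr k x : is_derive x 1 ( *%R k) k.
Proof. by rewrite -[X in is_derive _ _ _ X]mulr1; apply: is_deriveZ. Qed.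

Lemma is_derive_sin_mulr k x :
  is_derive x 1 (fun t => sin (k * t)) (k * cos (k * x)).
Proof.
have D := is_derive1_comp (is_derive_sin (k * x)) (is_derive_mulr k x).
by apply: (is_derive_eq D); rewrite mulrC.
Qed.

Lemma is_derive_cos_mulr k x :
  is_derive x 1 (fun t => cos (k * t)) (- k * sin (k * x)).
Proof.
have D := is_derive1_comp (is_derive_cos (k * x)) (is_derive_mulr k x).
by apply: (is_derive_eq D); rewrite mulrC mulrN mulNr.
Qed.

Lemma is_derive_expR_mulr k x :
  is_derive x 1 (fun t => expR (k * t)) (k * expR (k * x)).
Proof.
have D := is_derive1_comp (is_derive_expR (k * x)) (is_derive_mulr k x).
by apply: (is_derive_eq D); rewrite mulrC.
Qed.

(** Pointwise products instead of scalings, so that [ring] can close the side conditions below. *)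
Lemma is_deriveM_R f g x a b : is_derive x 1 f a -> is_derive x 1 g b ->
  is_derive x 1 (fun t => f t * g t) (f x * b + g x * a).
Proof. by move=> df dg; have := is_deriveM df dg. Qed.

Lemma is_deriveZ_R k f x a :
  is_derive x 1 f a -> is_derive x 1 (fun t => k * f t) (k * a).
Proof. by move=> df; have := is_deriveZ k df. Qed.

Section Neumann.
Variables (L lam : R) (phi : R -> R).
Hypotheses (L0 : 0 < L) (hphi : neumann_eigenfunction L lam phi).
Let psi := derive1 phi.

Let dphi x : x \in `]0, L[ -> is_derive x 1 phi (psi x).
Proof. by have [h _ _ _] := hphi => /h[/derivableP]; rewrite -derive1E. Qed.

Let dpsi x : x \in `]0, L[ -> is_derive x 1 psi (- lam * phi x).
Proof.
have [h _ _ _] := hphi => /h[_ /derivableP]; rewrite -derive1E => d2 e.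
by apply: (is_derive_eq d2); rewrite mulNr -e opprK.
Qed.

Let near0 : \forall x \near 0^'+, x \in `]0, L[.
Proof.
near=> x; rewrite in_itv/=; apply/andP; split; near: x.
  exact: nbhs_right_gt.
exact: nbhs_right_lt.
Unshelve. all: by end_near.
Qed.

Let nearL : \forall x \near L^'-, x \in `]0, L[.
Proof.
near=> x; rewrite in_itv/=; apply/andP; split; near: x.
  exact: nbhs_left_gt.
exact: nbhs_left_lt.
Unshelve. all: by end_near.
Qed.

Let mid : L / 2 \in `]0, L[.
Proof. by rewrite in_itv/= divr_gt0//= ltr_pdivrMr// ltr_pMr// ltr1n. Qed.

(* Variation of constants: [A] and [B] below are first integrals, equal to the
   coefficients of the solution up to a factor [k]. *)
Lemma neumann_eigenfunction_pos k : lam = k ^+ 2 -> 0 < k ->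
  sin (k * L) = 0 /\ exists a, {in `]0, L[, forall x, phi x = a * cos (k * x)}.
Proof.
move=> lamk k0; have kn0 : k != 0 by rewrite gt_eqF.
pose A x := phi x * (k * cos (k * x)) - psi x * sin (k * x).
pose B x := phi x * (k * sin (k * x)) + psi x * cos (k * x).
have dA x : x \in `]0, L[ -> is_derive x 1 A 0.
  move=> xL.
  have h1 := is_deriveM_R (dphi xL) (is_deriveZ_R k (is_derive_cos_mulr k x)).
  have h2 := is_deriveM_R (dpsi xL) (is_derive_sin_mulr k x).
  apply: (is_derive_eq (is_deriveB h1 h2)).
  by rewrite lamk; ring.
have dB x : x \in `]0, L[ -> is_derive x 1 B 0.
  move=> xL.
  have h1 := is_deriveM_R (dphi xL) (is_deriveZ_R k (is_derive_sin_mulr k x)).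
  have h2 := is_deriveM_R (dpsi xL) (is_derive_cos_mulr k x).
  apply: (is_derive_eq (is_deriveD h1 h2)).
  by rewrite lamk; ring.
pose a := A (L / 2). pose b := B (L / 2).
have Aa x : x \in `]0, L[ -> A x = a.
  by move=> xL; apply: is_derive_0_itv_cst dA _ _ xL mid.
have Bb x : x \in `]0, L[ -> B x = b.
  by move=> xL; apply: is_derive_0_itv_cst dB _ _ xL mid.
have psiE x : x \in `]0, L[ -> psi x = b * cos (k * x) - a * sin (k * x).
  move=> xL; rewrite -(Aa _ xL) -(Bb _ xL) /A /B.
  by rewrite -[LHS]mulr1 -(cos2Dsin2 (k * x)); ring.
have phiE x : x \in `]0, L[ ->
    phi x = k^-1 * (a * cos (k * x) + b * sin (k * x)).
  move=> xL; rewrite -(Aa _ xL) -(Bb _ xL) /A /B.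
  by rewrite -[LHS]mulr1 -(cos2Dsin2 (k * x)); field.
(* The formula for [psi] extends continuously to the endpoints, so the one-sided limits of [psi] can
   be read off at 0 and at [L]. *)
have cc : continuous (fun x => b * cos (k * x) - a * sin (k * x)).
  move=> x; apply/differentiable_continuous/derivable1_diffP.
  by have [] := is_deriveB (is_deriveZ_R b (is_derive_cos_mulr k x))
    (is_deriveZ_R a (is_derive_sin_mulr k x)).
have [_ psi0 psiL [x0 x0L phix0]] := hphi.
have b0 : b = 0.
  have h : b * cos (k * x) - a * sin (k * x) @[x --> 0^'+] --> (0 : R).
    apply: cvg_trans psi0; apply: near_eq_cvg; near=> x; apply: psiE.
    by near: x; exact: near0.
  have h' : b * cos (k * x) - a * sin (k * x) @[x --> 0^'+] --> b.
    have := cvg_at_right_filter (cc 0).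
    by rewrite mulr0 cos0 sin0 mulr1 mulr0 subr0.
  exact: (cvg_unique _ h' h).
have s0 : a * sin (k * L) = 0.
  have h : b * cos (k * x) - a * sin (k * x) @[x --> L^'-] --> (0 : R).
    apply: cvg_trans psiL; apply: near_eq_cvg; near=> x; apply: psiE.
    by near: x; exact: nearL.
  have h' := cvg_at_left_filter (cc L).
  have : b * cos (k * L) - a * sin (k * L) = 0 by exact: (cvg_unique _ h' h).
  by rewrite b0 mul0r sub0r => /eqP; rewrite oppr_eq0 => /eqP.
split; last by exists (k^-1 * a) => x xL; rewrite phiE// b0 mul0r addr0 mulrA.
move/eqP: s0; rewrite mulf_eq0 => /orP[/eqP a0|/eqP//].
by move: phix0; rewrite phiE// a0 b0 !mul0r addr0 mulr0 eqxx.
Unshelve. all: by end_near.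
Qed.

(** Here [psi] is constant on the interval, and its limit at 0 makes the constant vanish. *)
Lemma neumann_eigenfunction0 :
  lam = 0 -> exists a, {in `]0, L[, forall x, phi x = a}.
Proof.
move=> lam0.
have [_ psi0 _ _] := hphi.
have psiE x : x \in `]0, L[ -> psi x = psi (L / 2).
  move=> xL; apply: is_derive_0_itv_cst (xL) mid => y yL.
  by apply: (is_derive_eq (dpsi yL)); rewrite lam0 oppr0 mul0r.
have psim : psi (L / 2) = 0.
  apply: (cvg_unique _ _ psi0) => //.
  apply: cvg_near_cst; near=> x; apply: psiE.
  by near: x; exact: near0.
exists (phi (L / 2)) => x xL; apply: is_derive_0_itv_cst (xL) mid => y yL.
by apply: (is_derive_eq (dphi yL)); rewrite psiE.
Unshelve. all: by end_near.
Qed.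

(** For [lam = - k ^+ 2] the first integrals [A] and [B] are built from exponentials, and the
    boundary conditions force both to be 0, hence [phi] to vanish on the interval. *)
Lemma neumann_eigenvalue_ge0 : 0 <= lam.
Proof.
rewrite leNgt; apply/negP => lam0.
pose k := Num.sqrt (- lam).
have k0 : 0 < k by rewrite sqrtr_gt0 oppr_gt0.
have lamk : lam = - k ^+ 2 by rewrite sqr_sqrtr ?opprK// oppr_ge0 ltW.
pose A x := (psi x - k * phi x) * expR (k * x).
pose B x := (psi x + k * phi x) * expR (- k * x).
have dA x : x \in `]0, L[ -> is_derive x 1 A 0.
  move=> xL.
  have h := is_deriveM_R (is_deriveB (dpsi xL) (is_deriveZ_R k (dphi xL)))
    (is_derive_expR_mulr k x).
  by apply: (is_derive_eq h); rewrite !fctE lamk /=; ring.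
have dB x : x \in `]0, L[ -> is_derive x 1 B 0.
  move=> xL.
  have h := is_deriveM_R (is_deriveD (dpsi xL) (is_deriveZ_R k (dphi xL)))
    (is_derive_expR_mulr (- k) x).
  by apply: (is_derive_eq h); rewrite !fctE lamk /=; ring.
pose a := A (L / 2). pose b := B (L / 2).
have Aa x : x \in `]0, L[ -> A x = a.
  by move=> xL; apply: is_derive_0_itv_cst dA _ _ xL mid.
have Bb x : x \in `]0, L[ -> B x = b.
  by move=> xL; apply: is_derive_0_itv_cst dB _ _ xL mid.
have eN x : expR (k * x) * expR (- k * x) = 1.
  by rewrite -expRD mulNr addrN expR0.
have psiE x : x \in `]0, L[ ->
    psi x = 2^-1 * (a * expR (- k * x) + b * expR (k * x)).
  move=> xL; rewrite -(Aa _ xL) -(Bb _ xL) /A /B.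
  by rewrite -[LHS]mulr1 -[in LHS](eN x); field.
have phiE x : x \in `]0, L[ ->
    k * phi x = 2^-1 * (b * expR (k * x) - a * expR (- k * x)).
  move=> xL; rewrite -(Aa _ xL) -(Bb _ xL) /A /B.
  by rewrite -[LHS]mulr1 -[in LHS](eN x); field.
pose w x := 2^-1 * (a * expR (- k * x) + b * expR (k * x)).
have cc : continuous w.
  move=> x; apply/differentiable_continuous/derivable1_diffP.
  by have [] := is_deriveZ_R 2^-1 (is_deriveD
    (is_deriveZ_R a (is_derive_expR_mulr (- k) x))
    (is_deriveZ_R b (is_derive_expR_mulr k x))).
have [_ psi0 psiL [x0 x0L /eqP phix0]] := hphi.
have w0 : w 0 = 0.
  apply: (cvg_unique _ (cvg_at_right_filter (cc 0))) => //.
  apply: cvg_trans psi0; apply: near_eq_cvg; near=> x; apply: psiE.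
  by near: x; exact: near0.
have wL : w L = 0.
  apply: (cvg_unique _ (cvg_at_left_filter (cc L))) => //.
  apply: cvg_trans psiL; apply: near_eq_cvg; near=> x; apply: psiE.
  by near: x; exact: nearL.
(* The condition at 0 gives [a = - b]; the one at [L] then reads
   [b * (expR (k * L) - expR (- k * L)) = 0]. *)
have ab : a = - b by move: w0; rewrite /w !mulr0 expR0; lra.
have b0 : b = 0.
  have : expR (- k * L) < expR (k * L).
    by rewrite ltr_expR mulNr gtrN// mulr_gt0.
  move: wL; rewrite /w ab.
  set u := expR _; set v := expR _ => /eqP.
  rewrite mulf_eq0 invr_eq0 pnatr_eq0 /= => /eqP e uv.
  have : b * (v - u) = 0 by lra.
  by move=> /eqP; rewrite mulf_eq0 subr_eq0 (gt_eqF uv) orbF => /eqP.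
apply: phix0; apply: (mulfI (lt0r_neq0 k0)).
by rewrite phiE// ab b0 oppr0 !mul0r subr0 !mulr0.
Unshelve. all: by end_near.
Qed.

End Neumann.
End ODE.

(** * Eigenvalues, frequencies and their ordering *)

Section Cosines.
Context {R : realType}.
Implicit Types (k l L x y : R).

Lemma sin_natmul_pi n : sin (n%:R * pi) = 0 :> R.
Proof.
by rewrite mulr_natl -[_ *+ n]add0r (alternatingn (@sinDpi R)) sin0 mulr0.
Qed.

(** Removing the largest multiple of [pi] not exceeding [x] changes the sine by a sign only and
    leaves a remainder in [[0, pi[], where the sine vanishes only at 0. *)
Lemma sin_eq0 x : 0 <= x -> sin x = 0 -> exists n : nat, x = n%:R * pi.
Proof.
move=> x0 sx0; have pi0 := pi_gt0 R.
have := Num.Theory.truncn_itv (divr_ge0 x0 (ltW pi0)).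
set n := Num.truncn _; rewrite ler_pdivlMr// ltr_pdivrMr//.
rewrite -natr1 mulrDl mul1r => /andP[nx xn].
exists n; apply/eqP; rewrite -subr_eq0 eq_le subr_ge0 nx andbT leNgt.
apply/negP => y0.
have : sin (x - n%:R * pi) != 0 by rewrite gt_eqF// sin_gt0_pi// y0/= ltrBlDl.
have := alternatingn (@sinDpi R) n (x - n%:R * pi).
rewrite -[pi *+ n]mulr_natl subrK sx0 => /esym/eqP.
by rewrite mulf_eq0 signr_eq0 /= => ->.
Qed.

Lemma neumann_eigenfunction_cosine L (n : nat) : 0 < L ->
  neumann_eigenfunction L ((n%:R * pi / L) ^+ 2)
    (fun x => cos (n%:R * pi / L * x)).
Proof.
move=> L0; set k := n%:R * pi / L.
have d1 : derive1 (fun x => cos (k * x)) = (fun x => - k * sin (k * x)).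
  apply/funext => x; rewrite derive1E.
  by apply: derive_val; exact: is_derive_cos_mulr.
have d2 x := is_deriveZ_R (- k) (is_derive_sin_mulr k x).
have cs : continuous (fun x => - k * sin (k * x)).
  move=> x; apply/differentiable_continuous/derivable1_diffP.
  by have [] := d2 x.
split; rewrite ?d1.
- move=> x _; split.
  + by have [] := is_derive_cos_mulr k x.
  + by have [] := d2 x.
  + rewrite -[derive1n 2 _]/(derive1 (derive1 _)) d1 derive1E.
    have -> := @derive_val _ _ _ _ _ _ _ (d2 x). ring.
- by have := cvg_at_right_filter (cs 0); rewrite mulr0 sin0 mulr0.
- have := cvg_at_left_filter (cs L).
  by rewrite /k divfK ?gt_eqF// sin_natmul_pi mulr0.
have [->|k0] := eqVneq k 0.
  exists (L / 2); last by rewrite mul0r cos0 oner_neq0.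
  by rewrite in_itv/= divr_gt0//= ltr_pdivrMr// ltr_pMr// ltr1n.
have n0 : (0 < n)%N.
  by rewrite lt0n; apply: contra_neq k0 => n0; rewrite /k n0 !mul0r.
have n1 : 1 <= n%:R :> R by rewrite ler1n.
(* At this point the argument of the cosine is [pi / 4]. *)
exists (L / (4 * n%:R)).
  rewrite in_itv/= divr_gt0 ?mulr_gt0 ?ltr0n//= ltr_pdivrMr ?mulr_gt0 ?ltr0n//.
  by rewrite ltr_pMr//; lra.
rewrite gt_eqF// cos_gt0_pihalf//.
have -> : k * (L / (4 * n%:R)) = pi / 4.
  by rewrite /k; field; rewrite (gt_eqF L0) pnatr_eq0 -lt0n n0.
by have := pi_gt0 R => pi0; apply/andP; split; lra.
Qed.

Lemma neumann_eigenfunctionP L lam phi :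
  0 < L -> neumann_eigenfunction L lam phi ->
  exists n : nat, lam = (n%:R * pi / L) ^+ 2 /\
    exists2 a, a != 0 &
      {in `]0, L[, forall x, phi x = a * cos (n%:R * pi / L * x)}.
Proof.
move=> L0 h.
suff [n [lamE [a aE]]] : exists n : nat, lam = (n%:R * pi / L) ^+ 2 /\
    exists a, {in `]0, L[, forall x, phi x = a * cos (n%:R * pi / L * x)}.
  exists n; split => //; exists a => //.
  have [_ _ _ [x xL]] := h; rewrite aE//; apply: contra_neq => ->.
  by rewrite mul0r.
have := neumann_eigenvalue_ge0 L0 h.
rewrite le_eqVlt => /predU1P[/esym lam0|lam0].
  exists 0; rewrite !mul0r expr0n; split => //.
  have [a aE] := neumann_eigenfunction0 L0 h lam0; exists a => x xL.
  by rewrite mul0r cos0 mulr1 aE.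
pose k := Num.sqrt lam.
have k0 : 0 < k by rewrite sqrtr_gt0.
have lamk : lam = k ^+ 2 by rewrite sqr_sqrtr// ltW.
have [skL phiE] := neumann_eigenfunction_pos L0 h lamk k0.
have [n nE] := sin_eq0 (ltW (mulr_gt0 k0 L0)) skL.
have kE : k = n%:R * pi / L by rewrite -nE mulfK// gt_eqF.
by exists n; rewrite -kE.
Qed.

(** Monotonicity gives [i <= f i]. If [i < f i], the value [i] is attained at some [j < i], where
    [f j = j] by induction. *)
Lemma surj_incr_id (f : nat -> nat) : {homo f : i j / (i < j)%N} ->
  (forall n, exists i, f i = n) -> f =1 id.
Proof.
move=> fi fs.
have ge i : (i <= f i)%N.
  by elim: i => // i IH; exact: leq_ltn_trans IH (fi _ _ (leqnn _)).
elim/ltn_ind => i IH; apply/eqP; rewrite eqn_leq ge andbT leqNgt.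
apply/negP => lt.
have [j fj] := fs i.
have ji : (j < i)%N.
  have [//|/fi ij|ij] := ltngtP j i; last by move: lt; rewrite -ij fj ij ltnn.
  by move: ij; rewrite fj ltnNge ltnW.
by move: (ji); rewrite -fj IH// ltnn.
Qed.

(** The frequency [f i] of [e i] increases strictly with [i], and every integer occurs because every
    cosine is an eigenfunction; so [f] is the identity. *)
Lemma neumann_eigensystemP L (lam : nat -> R) e : 0 < L ->
  neumann_eigensystem L lam e -> forall i : nat,
    exists2 a, a != 0 &
      {in `]0, L[, forall x, e i x = a * cos (i%:R * pi / L * x)}.
Proof.
move=> L0 [eP lam_incr lam_surj].
have /choice[f fP] i := neumann_eigenfunctionP L0 (eP i).
have ltE m n : ((m%:R * pi / L) ^+ 2 < (n%:R * pi / L) ^+ 2 :> R) = (m < n)%N.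
  have pos (j : nat) : 0 <= j%:R * pi / L.
    by rewrite !mulr_ge0 ?pi_ge0// invr_ge0 ltW.
  by rewrite ltr_sqr ?nnegrE// -!mulrA ltr_pM2r ?ltr_nat// divr_gt0// pi_gt0.
have fid : f =1 id.
  apply: surj_incr_id => [i j ij|n].
    by rewrite -ltE -(fP i).1 -(fP j).1 lam_incr.
  have [i e'] := lam_surj _ _ (neumann_eigenfunction_cosine n L0); exists i.
  move: e'; rewrite (fP i).1 => e'.
  have := ltE n (f i); have := ltE (f i) n; rewrite -e' ltxx => h1 h2.
  by apply/eqP; rewrite eqn_leq leqNgt -h2 leqNgt -h1.
by move=> i; have [_] := fP i; rewrite fid.
Qed.

End Cosines.

(** * The function sinc and the discrete cosine transform *)

Section Sinc.
Context {R : realType}.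
Implicit Types (s t x y : R).

(** The value 1 at 0 lets the constant mode obey the same formulas as the other cosines. *)
Definition sinc x : R := if x == 0 then 1 else sin x / x.

Lemma sin_mvt s t : s < t ->
  exists2 x, s < x < t & sin t - sin s = cos x * (t - s).
Proof.
move=> st.
have cs : {within `[s, t], continuous sin}.
  exact/continuous_subspaceT/continuous_sin.
have [x xst ->] := MVT st (fun x _ => is_derive_sin x) cs.
by exists x => //; move: xst; rewrite in_itv.
Qed.

(** Concavity of the sine: its chord slope over [[0, s]] is some [cos x] with [x < s], and over
    [[s, t]] a smaller [cos y] with [s < y], so the slope over [[0, t]] is below [cos x]. *)
Lemma sinc_lt s t : 0 <= s -> s < t -> t <= pi / 2 -> sinc t < sinc s.
Proof.
move=> s0 st tpi; have t0 : 0 < t := le_lt_trans s0 st.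
have pi0 := pi_gt0 R.
have cos_lt x y : 0 <= x -> x < y -> y < t -> cos y < cos x.
  by move=> x0 xy yt; rewrite ltr_cos// in_itv/=; apply/andP; split; lra.
have [y /andP[sy yt] ey] := sin_mvt st.
rewrite /sinc (gt_eqF t0); have [se|sn0] := eqVneq s 0.
  have [x /andP[x0 xt]] := sin_mvt t0; rewrite sin0 !subr0 => ->.
  by rewrite mulfK ?gt_eqF// -cos0 cos_lt.
have sp : 0 < s by rewrite lt0r sn0.
have [x /andP[x0 xs] ex] := sin_mvt sp.
move: ex; rewrite sin0 !subr0 => ex.
have cxy : cos y < cos x by apply: cos_lt => //; lra.
rewrite ex mulfK// ltr_pdivrMr// -(subrK (sin s) (sin t)) ey ex.
nra.
Qed.

Lemma sinc_gt0 t : 0 <= t -> t <= pi / 2 -> 0 < sinc t.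
Proof.
move=> t0 tpi; rewrite /sinc; case: eqVneq => // tn0.
have tp : 0 < t by rewrite lt0r tn0.
by rewrite divr_gt0// sin_gt0_pi// tp/=; have := pi_gt0 R; lra.
Qed.

(** Multiplied by the sine of the half step [h], the sum telescopes to [sin (n%:R * pi) / 2]. The
    bounds on [n] place [h] strictly between 0 and [pi], so that [sin h] can be cancelled. *)
Lemma cos_sum_midpoints (M n : nat) : (0 < n < M.*2)%N ->
  \sum_(j < M) cos (n%:R * (pi * (2 * j%:R + 1) / (2 * M%:R))) = 0 :> R.
Proof.
move=> /andP[n0 n2M].
have M0 : (0 < M)%N by case: M n2M.
have Mn0 : M%:R != 0 :> R by rewrite pnatr_eq0 -lt0n.
have pi0 := pi_gt0 R.
pose h : R := n%:R * pi / (2 * M%:R).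
have sh : sin h != 0.
  rewrite gt_eqF// sin_gt0_pi//; apply/andP; split.
    by rewrite /h divr_gt0// mulr_gt0// ltr0n.
  rewrite /h ltr_pdivrMr ?mulr_gt0 ?ltr0n// mulrC ltr_pM2l// -natrM ltr_nat.
  by rewrite mul2n.
apply: (mulfI sh); rewrite mulr0 mulr_sumr.
pose f (j : nat) : R := sin (2 * j%:R * h) / 2.
have step (j : nat) :
    sin h * cos (n%:R * (pi * (2 * j%:R + 1) / (2 * M%:R))) = f j.+1 - f j.
  have -> : n%:R * (pi * (2 * j%:R + 1) / (2 * M%:R)) = (2 * j%:R + 1) * h.
    by rewrite /h; field.
  rewrite /f -[j.+1%:R]natr1.
  have -> : 2 * (j%:R + 1) * h = (2 * j%:R + 1) * h + h by ring.
  have -> : 2 * j%:R * h = (2 * j%:R + 1) * h - h by ring.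
  by rewrite sinD sinB; field.
under eq_bigr do rewrite step.
rewrite -(big_mkord xpredT (fun j => f j.+1 - f j)) telescope_sumr// /f.
rewrite mulr0 mul0r sin0 mul0r subr0.
have -> : 2 * M%:R * h = n%:R * pi by rewrite /h; field.
by rewrite sin_natmul_pi mul0r.
Qed.

(** The type II discrete cosine transform matrix: cosine [i] at [center L M j.+1], hence [2 * j + 1]
    in place of [2 * j - 1]. *)
Definition midcos M (i j : nat) : R :=
  cos (i%:R * (pi * (2 * j%:R + 1) / (2 * M%:R))).

(** The product is a half-sum of cosines of frequencies [i - k] and [i + k], both below [M.*2], so
    only a zero frequency contributes. For [i = k = 0] both do, which doubles the value. *)
Lemma midcos_orth (M i k : nat) : (i < M)%N -> (k < M)%N ->
  \sum_(j < M) midcos M i j * midcos M k j =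
  (i == k)%:R * (if i == 0%N then M%:R else M%:R / 2).
Proof.
move=> iM kM.
(* Makes the truncated difference [i - k] a genuine one. *)
wlog ki : i k iM kM / (k <= i)%N.
  move=> H; have [/H|/ltnW/H] := leqP k i; first exact.
  move=> /(_ kM iM) e; rewrite eq_sym; under eq_bigr do rewrite mulrC.
  rewrite e.
  by case: eqVneq => [->|]//; rewrite !mul0r.
have prod (j : nat) : midcos M i j * midcos M k j =
   2^-1 * cos ((i - k)%:R * (pi * (2 * j%:R + 1) / (2 * M%:R))) +
   2^-1 * cos ((i + k)%:R * (pi * (2 * j%:R + 1) / (2 * M%:R))).
  rewrite /midcos; set a := pi * _ / _.
  by rewrite natrB// natrD mulrBl mulrDl cosB cosD; field.
under eq_bigr do rewrite prod.
rewrite big_split/= -!mulr_sumr.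
have nM : (i + k < M.*2)%N by rewrite -addnn; lia.
have sum0 :
    \sum_(j < M) cos (0%:R * (pi * (2 * j%:R + 1) / (2 * M%:R))) = M%:R :> R.
  under eq_bigr do rewrite mul0r cos0.
  by rewrite sumr_const card_ord.
have [eik|nik] := eqVneq i k; last first.
  by rewrite !cos_sum_midpoints ?mulr0 ?addr0 ?mul0r//; lia.
rewrite -eik subnn sum0 mul1r; have [->|i0] := eqVneq i 0%N.
  by rewrite addn0 sum0; lra.
by rewrite cos_sum_midpoints ?mulr0 ?addr0 1?mulrC//; lia.
Qed.

End Sinc.

(** * Cosines and indicators in L^2(0, L) *)

Lemma bounded_Lfun2 d (T : measurableType d) (R : realType)
    (mu : {measure set T -> \bar R}) (f : T -> R) :
  (mu setT < +oo)%E -> measurable_fun setT f -> (forall t, `|f t| <= 1) ->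
  f \in Lfun mu 2%:E.
Proof.
move=> mufin mf f1; rewrite inE; apply/andP; split; rewrite inE//=.
rewrite /finite_norm unlock poweR_lty//.
apply: (@le_lt_trans _ _ (\int[mu]_x (1%:E))%E); last first.
  by rewrite integral_cst// mul1e.
apply: ge0_le_integral => //.
- by move=> t _; exact: poweR_ge0.
- apply: (measurableT_comp (@measurable_poweR R 2)).
  by apply: measurableT_comp => //; apply/measurable_EFinP.
by move=> t _; rewrite lee_fin powR_mulrn// exprn_ile1.
Qed.

Section Integrals.
Context {R : realType} {L : R}.
Hypothesis L0 : 0 < L.
Implicit Types (a b x k : R) (f F : R -> R).
Local Notation mu := (mu0 L).

Lemma mu0_fin : (mu setT < +oo)%E.
Proof.
by rewrite /= /mrestr setTI lebesgue_measure_itv/= lte_fin L0 -EFinB ltry.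
Qed.

(** The whole complement of []0, L[] serves as the exceptional set, since [mu0 L] does not charge
    it. *)
Lemma ae_mu0 (P : R -> Prop) :
  {in `]0, L[, forall x, P x} -> {ae mu, forall x, P x}.
Proof.
move=> PL; exists (~` `]0, L[%classic); split.
- exact: measurableC.
- by rewrite /= /mrestr setICl measure0.
by apply: subsetC => x xL; apply: PL.
Qed.

Lemma Rintegral_mu0_itv a b F f : 0 <= a -> a < b -> b <= L ->
  (forall x, is_derive x 1 F (f x)) -> continuous f ->
  (\int[mu]_t (\1_(`]a, b[) t * f t))%R = F b - F a.
Proof.
move=> a0 ab bL dF cf.
have -> : (\int[mu]_t (\1_(`]a, b[) t * f t))%R =
    (\int[mu]_(t in `]a, b[) f t)%R.
  rewrite [RHS]Rintegral_mkcond; apply: eq_Rintegral => t _.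
  by rewrite patchE indicE; case: ifP; rewrite ?mul1r ?mul0r.
have e : (\int[mu]_(t in `]a, b[) (f t)%:E =
    \int[lebesgue_measure]_(t in `]a, b[) (f t)%:E)%E.
  apply: eq_measure_integral => A mA Aab; rewrite /= /mrestr setIidl//.
  apply: subset_trans Aab _ => t /=; rewrite !in_itv/= => /andP[at_ tb].
  by rewrite (le_lt_trans a0 at_) (lt_le_trans tb bL).
rewrite /Rintegral e.
rewrite (_ : (\int[_]_(t in _) _)%E = (F b)%:E - (F a)%:E)%E//.
rewrite -(@continuous_FTC2 _ f F a b)//.
(* Passes from the open interval to the closed one of [continuous_FTC2]; the endpoints are null. *)
- have mf (i : interval R) : measurable_fun [set` i] (EFin \o f).
    apply/measurable_EFinP/measurable_funTS; exact: continuous_measurable_fun.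
  by rewrite integral_itv_obnd_cbnd// integral_itv_bndo_bndc.
- exact: continuous_subspaceT.
- have cF : continuous F.
    move=> x; apply/differentiable_continuous/derivable1_diffP.
    by have [] := dF x.
  split; first by move=> x _; have [] := dF x.
    exact/cvg_at_right_filter/cF.
  exact/cvg_at_left_filter/cF.
by move=> x _; rewrite derive1E; apply: derive_val.
Qed.

Definition cos_primitive k x := if k == 0 then x else sin (k * x) / k.

Lemma is_derive_cos_primitive k x :
  is_derive x 1 (cos_primitive k) (cos (k * x)).
Proof.
rewrite /cos_primitive; have [->|k0] := eqVneq k 0.
  by rewrite mul0r cos0; exact: is_derive_id.
have := is_deriveZ_R k^-1 (is_derive_sin_mulr k x).
rewrite mulKf//; under eq_fun do rewrite mulrC; exact.
Qed.

Lemma continuous_cos_mulr k : continuous (fun x : R => cos (k * x)).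
Proof.
move=> x; apply/differentiable_continuous/derivable1_diffP.
by have [] := is_derive_cos_mulr k x.
Qed.

(** The origin of the factorization [s i * v i j]: the half-width [h] enters only through
    [2 * h * sinc (k * h)], the center [x] only through the cosine. *)
Lemma cos_primitive_midpoint k x h :
  cos_primitive k (x + h) - cos_primitive k (x - h) =
  2 * h * sinc (k * h) * cos (k * x).
Proof.
rewrite /cos_primitive /sinc mulf_eq0; have [->|k0] := eqVneq k 0.
  by rewrite /= !mul0r cos0; ring.
have [->|h0] := eqVneq h 0; first by rewrite addr0 subr0 subrr; ring.
by rewrite /= mulrDr mulrBr sinD sinB; field; rewrite h0 k0.
Qed.

Lemma Lfun2_cos k : (fun x : R => cos (k * x)) \in Lfun mu 2%:E.
Proof.
apply: bounded_Lfun2 => [||x]; [exact: mu0_fin| |exact: cos_max].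
exact: (continuous_measurable_fun (@continuous_cos_mulr k)).
Qed.

Lemma Lfun2_indic a b : (\1_(`]a, b[) : R -> R) \in Lfun mu 2%:E.
Proof.
apply: bounded_Lfun2 => [||x]; [exact: mu0_fin|exact: measurable_indic|].
by rewrite indicE ger0_norm// lern1; case: (_ \in _).
Qed.

Lemma L2dot_indic_cos a h k : 0 <= a - h -> 0 < h -> a + h <= L ->
  L2dot L \1_(`]a - h, a + h[) (fun x => cos (k * x)) =
  2 * h * sinc (k * h) * cos (k * a).
Proof.
move=> ah h0 ahL; rewrite -cos_primitive_midpoint.
apply: Rintegral_mu0_itv => //; first lra.
- exact: is_derive_cos_primitive.
- exact: continuous_cos_mulr.
Qed.

Lemma L2dot_indic a b : 0 <= a -> a < b -> b <= L ->
  L2dot L \1_(`]a, b[) \1_(`]a, b[) = b - a.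
Proof.
move=> a0 ab bL; rewrite -(@Rintegral_mu0_itv a b id (cst 1))//.
  apply: eq_Rintegral => t _; rewrite indicE.
  by case: (_ \in _); rewrite ?mulr1 ?mulr0.
exact: cst_continuous.
Qed.

Lemma L2dot_indic_disjoint a b c d : b <= c ->
  L2dot L \1_(`]a, b[) \1_(`]c, d[) = 0.
Proof.
move=> bc; rewrite /L2dot -[RHS](@L2dot0l R L (cst 0)).
apply: eq_Rintegral => t _; rewrite !indicE -natrM mulnb.
case: (boolP (_ && _)) => [|_]; last by rewrite mul0r.
move=> /andP[/set_mem/= + /set_mem/=].
rewrite !in_itv/= => /andP[_ tb] /andP[ct _].
by have := lt_le_trans tb bc; rewrite ltNge (ltW ct).
Qed.

Definition neumann_cosine (i : nat) x := cos (i%:R * pi / L * x).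

(** The continuous counterpart of [midcos_orth]: primitives of the cosines of frequencies [i - k]
    and [i + k] vanish at 0, and at [L] unless the frequency is 0. *)
Lemma L2dot_cosines (i k : nat) :
  L2dot L (neumann_cosine i) (neumann_cosine k) =
  (i == k)%:R * (if i == 0%N then L else L / 2).
Proof.
wlog ki : i k / (k <= i)%N.
  move=> H; have [/H//|/ltnW/H] := leqP k i.
  rewrite L2dotC => ->; rewrite eq_sym; case: eqVneq => [->|]//.
  by rewrite !mul0r.
pose w n := n%:R * pi / L.
pose F x :=
  2^-1 * (cos_primitive (w (i - k)%N) x + cos_primitive (w (i + k)%N) x).
have dF x : is_derive x 1 F (neumann_cosine i x * neumann_cosine k x).
  have D := is_deriveZ_R 2^-1 (is_deriveD
    (is_derive_cos_primitive (w (i - k)%N) x)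
    (is_derive_cos_primitive (w (i + k)%N) x)).
  apply: (is_derive_eq D).
  rewrite /neumann_cosine /w natrB// natrD !mulrBl !mulrDl cosB cosD.
  by field.
have cF : continuous (fun x => neumann_cosine i x * neumann_cosine k x).
  by move=> x; apply: cvgM; exact: continuous_cos_mulr.
have prim0 n : cos_primitive (w n) 0 = 0.
  by rewrite /cos_primitive mulr0 sin0 mul0r if_same.
have primL n : cos_primitive (w n) L = (n == 0%N)%:R * L.
  rewrite /cos_primitive /w !mulf_eq0 invr_eq0 (gt_eqF L0).
  rewrite (gt_eqF (pi_gt0 R)) !orbF pnatr_eq0.
  case: eqVneq => [_|_]; first by rewrite mul1r.
  by rewrite divfK ?gt_eqF// sin_natmul_pi !mul0r.
have sL : (\1_(`]0, L[) : R -> R) \in Lfun mu 2%:E := Lfun2_indic 0 L.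
have -> : L2dot L (neumann_cosine i) (neumann_cosine k) =
    (\int[mu]_t (\1_(`]0, L[) t * (neumann_cosine i t * neumann_cosine k t)))%R.
  congr fine; apply: ae_eq_integral => //.
  - by apply/measurable_EFinP; exact: continuous_measurable_fun cF.
  - apply/measurable_EFinP/measurable_funM; first exact: measurable_indic.
    exact: continuous_measurable_fun cF.
  apply: ae_mu0 => t tL _; rewrite indicE mem_set ?mul1r//.
rewrite (Rintegral_mu0_itv _ _ _ dF cF)// /F !prim0 !primL subn_eq0 addn_eq0.
rewrite addr0 mulr0 subr0.
have [->|ik] := eqVneq i k.
  by rewrite leqnn andbb; case: eqVneq => _; rewrite !mul1r ?mul0r; field.
have -> : (i <= k)%N = false.
  by apply/negbTE; rewrite -ltnNge ltn_neqAle eq_sym ik.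
have -> : (i == 0%N) && (k == 0%N) = false.
  by apply: contraNF ik => /andP[/eqP-> /eqP->].
by rewrite !mul0r addr0 mulr0.
Qed.

End Integrals.

Arguments neumann_cosine {R} L i x.

(** * The oblique projection for the actuators *)

Section Actuators.
Context {R : realType}.
Variables (L r : R).
Hypotheses (L0 : 0 < L) (r0 : 0 < r) (r1 : r < 1).

(** Rescaling the generators by nonzero factors does not change their span. *)
Lemma eigen_span_cosines lam e M : neumann_eigensystem L lam e ->
  eigen_span L e M = L2span (fun i : 'I_M => neumann_cosine L i).
Proof.
move=> he.
have /choice[a aP] i : exists a, a != 0 /\
    {in `]0, L[, forall x, e i x = a * neumann_cosine L i x}.
  by have [a a0 aE] := neumann_eigensystemP L0 he i; exists a.
have eE : {ae mu0 L, forall x, forall i, e i x = a i * neumann_cosine L i x}.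
  by apply: ae_mu0 => // x xL i; apply: (aP i).2.
apply/seteqP; split=> y [b yE].
  exists (fun i => b i * a i); apply: filterS2 yE eE => x yx ex ?.
  by rewrite yx//; apply: eq_bigr => i _; rewrite ex mulrA.
exists (fun i => b i / a i); apply: filterS2 yE eE => x yx ex ?.
by rewrite yx//; apply: eq_bigr => i _; rewrite ex mulrA divfK// (aP i).1.
Qed.

(** Frequency [q * pi / L] times the half-width [r * L / (2 * M%:R)]. A real [q] allows
    [M%:R - 1]. *)
Definition sinc_arg (M : nat) (q : R) : R := q * pi * r / (2 * M%:R).

Section FixedM.
Variable M : nat.
Hypothesis M0 : (0 < M)%N.

Let u (j : 'I_M) : R -> R := \1_(actuator_domain L r M j.+1).
Let c (i : 'I_M) := neumann_cosine L i.
Let w := r * L / M%:R.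
Let N (i : 'I_M) := if i == 0%N :> nat then L else L / 2.
Let d (i : 'I_M) : R := if i == 0%N :> nat then M%:R else M%:R / 2.
Let s (i : 'I_M) := w * sinc (sinc_arg M i%:R).
Let v (i j : 'I_M) : R := midcos M i j.

Let Mp : 0 < M%:R :> R. Proof. by rewrite ltr0n. Qed.
Let h := r * L / (2 * M%:R).
Let h0 : 0 < h. Proof. by rewrite divr_gt0 ?mulr_gt0. Qed.
Let w2h : w = 2 * h. Proof. by rewrite /w /h; field; rewrite gt_eqF. Qed.
Let w0 : 0 < w. Proof. by rewrite w2h mulr_gt0. Qed.

Lemma sinc_arg_bounds (q : R) :
  0 <= q -> q <= M%:R -> 0 <= sinc_arg M q <= pi / 2.
Proof.
move=> q0 qM; rewrite /sinc_arg; have pi0 := pi_gt0 R; apply/andP; split.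
  by rewrite divr_ge0 ?mulr_ge0// ltW.
rewrite ler_pdivrMr ?mulr_gt0//.
have -> : pi / 2 * (2 * M%:R) = M%:R * pi :> R by field.
by rewrite -mulrA ler_pM// ?mulr_ge0 ?ltW// gtr_pMr.
Qed.

Let sinc_p (i : 'I_M) : 0 < sinc (sinc_arg M i%:R).
Proof.
have /andP[] : 0 <= sinc_arg M i%:R <= pi / 2.
  by apply: sinc_arg_bounds => //; rewrite ler_nat ltnW.
exact: sinc_gt0.
Qed.

Let center_lo (j : 'I_M) : 0 <= center L M j.+1 - h.
Proof.
rewrite /center /h -[j.+1%:R]natr1.
have -> : (2 * (j%:R + 1) - 1) * L / (2 * M%:R) - r * L / (2 * M%:R) =
  (2 * j%:R + (1 - r)) * L / (2 * M%:R) by field; rewrite gt_eqF.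
apply: divr_ge0; last by rewrite mulr_ge0// ltW.
by rewrite mulr_ge0 ?(ltW L0)// addr_ge0 ?subr_ge0 ?(ltW r1)// mulr_ge0.
Qed.

Let center_hi (j : 'I_M) : center L M j.+1 + h <= L.
Proof.
rewrite /center /h -[j.+1%:R]natr1 -mulrDl ler_pdivrMr ?mulr_gt0// -mulrDl.
rewrite [leRHS]mulrC ler_pM2r//.
have : j%:R + 1 <= M%:R :> R by rewrite natr1 ler_nat.
by have := r1; lra.
Qed.

(** Adjacent centers are [L / M] apart and each actuator has width [r * L / M], so [r < 1] leaves a
    gap. *)
Let center_sep (j k : 'I_M) :
  (j < k)%N -> center L M j.+1 + h <= center L M k.+1 - h.
Proof.
move=> jk; rewrite -subr_ge0 /center /h -[j.+1%:R]natr1 -[k.+1%:R]natr1.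
have -> : (2 * (k%:R + 1) - 1) * L / (2 * M%:R) - r * L / (2 * M%:R) -
   ((2 * (j%:R + 1) - 1) * L / (2 * M%:R) + r * L / (2 * M%:R)) =
  (k%:R - (j%:R + 1) + (1 - r)) * L / M%:R by field; rewrite gt_eqF.
have : j%:R + 1 <= k%:R :> R by rewrite natr1 ler_nat.
by move=> jk1; rewrite divr_ge0 ?mulr_ge0// ?ltW//; have := r1; lra.
Qed.

Let us j : u j \in Lfun (mu0 L) 2%:E. Proof. exact: Lfun2_indic. Qed.
Let cs i : c i \in Lfun (mu0 L) 2%:E. Proof. exact: Lfun2_cos. Qed.

Let N0 i : 0 < N i.
Proof. by rewrite /N; case: ifP => // _; rewrite divr_gt0. Qed.

Let d0 i : 0 < d i.
Proof. by rewrite /d; case: ifP => // _; rewrite divr_gt0. Qed.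

Let s0 i : 0 < s i. Proof. by rewrite mulr_gt0. Qed.

Let uu j k : L2dot L (u j) (u k) = (j == k)%:R * w.
Proof.
rewrite -val_eqE /=; case: ltngtP => [jk|kj|/val_inj ->].
- by rewrite mul0r L2dot_indic_disjoint// center_sep.
- by rewrite mul0r L2dotC L2dot_indic_disjoint// center_sep.
rewrite mul1r L2dot_indic //.
- by rewrite -/h w2h; ring.
- by rewrite -/h; have := h0; lra.
Qed.

Let cc i k : L2dot L (c i) (c k) = (i == k)%:R * N i.
Proof. by rewrite L2dot_cosines. Qed.

Let uc i j : L2dot L (u j) (c i) = s i * v i j.
Proof.
rewrite L2dot_indic_cos// ?center_lo ?center_hi// -/h -w2h /s /v /midcos.
congr (_ * sinc _ * cos _).
  by rewrite /sinc_arg /h; field; rewrite !gt_eqF.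
by rewrite /center -[j.+1%:R]natr1; field; rewrite !gt_eqF.
Qed.

Let vv i k : \sum_(j < M) v i j * v k j = (i == k)%:R * d i.
Proof. by rewrite midcos_orth. Qed.

Lemma actuator_direct_sum :
  direct_sum (L2span u : set (L2 L)) (L2orth (L2span c)).
Proof. exact: oblique_direct_sum us cs w0 s0 d0 uu uc vv. Qed.

(** [N i / d i] is [L / M] for every [i], the constant mode included. *)
Let KE i : w * N i / (s i ^+ 2 * d i) = (r * sinc (sinc_arg M i%:R) ^+ 2)^-1.
Proof.
have NdE : N i = L / M%:R * d i.
  by rewrite /N /d; case: ifP => _; field; rewrite gt_eqF.
by rewrite NdE /s /w; field; rewrite !gt_eqF.
Qed.

Lemma actuator_opnorm : (1 < M)%N ->
  opnorm (oblique_proj (L2span u : set (L2 L)) (L2orth (L2span c))) =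
  (Num.sqrt r * sinc (sinc_arg M (M%:R - 1)))^-1%:E.
Proof.
move=> M1; have M1M : (M.-1 < M)%N by rewrite prednK.
(* Ordinals count from 0, so the last cosine has frequency [M - 1]; there [sinc] is smallest. *)
pose i0 := Ordinal M1M.
have i0E : i0%:R = M%:R - 1 :> R by rewrite /= -subn1 natrB.
rewrite (oblique_opnorm us cs w0 N0 s0 d0 uu cc uc vv (i0 := i0)) => [|i].
  have rs0 : 0 <= r * sinc (sinc_arg M i0%:R) ^+ 2.
    by rewrite mulr_ge0 ?sqr_ge0 ?ltW.
  rewrite KE -i0E sqrtrV// sqrtrM ?(ltW r0)// sqrtr_sqr.
  by rewrite ger0_norm// ltW.
rewrite !KE lef_pV2 ?posrE ?mulr_gt0 ?exprn_gt0//.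
rewrite ler_pM2l// ler_pXn2r ?nnegrE ?(ltW (sinc_p _))//.
have [->|ii0] := eqVneq i i0; first exact: lexx.
have lt : (i < i0)%N by rewrite ltn_neqAle ii0/= -ltnS prednK.
have b1 : sinc_arg M i%:R < sinc_arg M i0%:R.
  rewrite /sinc_arg -!mulrA ltr_pM2r ?ltr_nat//.
  by rewrite !mulr_gt0 ?pi_gt0 ?invr_gt0 ?mulr_gt0.
have /andP[? _] : 0 <= sinc_arg M i%:R <= pi / 2.
  by apply: sinc_arg_bounds => //; rewrite ler_nat ltnW.
have /andP[_ ?] : 0 <= sinc_arg M i0%:R <= pi / 2.
  by apply: sinc_arg_bounds => //; rewrite ler_nat ltnW.
exact/ltW/sinc_lt.
Qed.

End FixedM.
End Actuators.

(** * Closed form, monotonicity and limit of the norm *)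

Section Limit.
Context {R : realType}.
Variable r : R.
Hypotheses (r0 : 0 < r) (r1 : r < 1).

Definition norm_arg (M : nat) : R := sinc_arg r M (M%:R - 1).

(** This form shows both the growth in [M] and the limit [r * pi / 2]. *)
Lemma norm_argE M : (0 < M)%N -> norm_arg M = r * pi / 2 * (1 - M%:R^-1).
Proof.
move=> M0; rewrite /norm_arg /sinc_arg; field.
by rewrite pnatr_eq0 -lt0n.
Qed.

Lemma norm_arg_lt M N : (0 < M)%N -> (M < N)%N -> norm_arg M < norm_arg N.
Proof.
move=> M0 MN; rewrite !norm_argE ?(ltn_trans _ MN)//.
rewrite ltr_pM2l ?divr_gt0 ?mulr_gt0 ?pi_gt0// ltrD2l ltrN2.
by rewrite ltf_pV2 ?posrE ?ltr0n ?(ltn_trans _ MN)// ltr_nat.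
Qed.

Lemma norm_arg_bounds M : (1 < M)%N -> 0 < norm_arg M <= pi / 2.
Proof.
move=> M1; have q0 : 0 <= M%:R - 1 :> R by rewrite subr_ge0 ler1n ltnW.
have qM : M%:R - 1 <= M%:R :> R by rewrite gerBl.
have /andP[_ ->] := sinc_arg_bounds r0 r1 (ltnW M1) q0 qM.
rewrite andbT norm_argE ?(ltnW M1)//.
rewrite mulr_gt0 ?divr_gt0 ?mulr_gt0 ?pi_gt0//.
by rewrite subr_gt0 invf_lt1 ?ltr0n ?ltr1n// ltnW.
Qed.

Lemma powR_sinc M : (1 < M)%N ->
  (Num.sqrt r * sinc (norm_arg M))^-1 =
  (4 * M%:R ^+ 2 / (r * pi ^+ 2 * (M%:R - 1) ^+ 2)
            * sin (r * pi * (M%:R - 1) / (2 * M%:R)) ^+ 2) `^ (- (1 / 2)).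
Proof.
move=> M1; have /andP[t0 tpi] := norm_arg_bounds M1.
have sp := sinc_gt0 (ltW t0) tpi.
have M10 : M%:R - 1 != 0 :> R by rewrite subr_eq0 pnatr_eq1 gtn_eqF.
have Mn0 : M%:R != 0 :> R by rewrite pnatr_eq0 -lt0n ltnW.
rewrite [X in X `^ _](_ : _ = r * sinc (norm_arg M) ^+ 2).
  have rs0 : 0 <= r * sinc (norm_arg M) ^+ 2 by rewrite mulr_ge0 ?sqr_ge0 ?ltW.
  rewrite div1r powRN powR12_sqrt// sqrtrM ?(ltW r0)// sqrtr_sqr.
  by rewrite ger0_norm// ltW.
have -> : r * pi * (M%:R - 1) / (2 * M%:R) = norm_arg M.
  by rewrite /norm_arg /sinc_arg; congr (_ / _); ring.
rewrite /sinc gt_eqF//; set sn := sin _; rewrite /norm_arg /sinc_arg.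
(* With the sine and [pi] generalized, a rational identity remains. *)
move: sn pi (pi_gt0 R) => sn p p0; field.
by rewrite M10 Mn0 !gt_eqF.
Qed.

Lemma cvg_sinc (x : R) : 0 < x -> sinc y @[y --> x] --> sinc x.
Proof.
move=> x0; rewrite [in X in _ --> X]/sinc gt_eqF//.
have h : sin y / y @[y --> x] --> sin x / x.
  apply: cvgM; first exact: continuous_sin.
  by apply: cvgV; [rewrite gt_eqF|exact: cvg_id].
apply: cvg_trans h; apply: near_eq_cvg; near=> y.
rewrite /sinc gt_eqF//; near: y; exact: lt_nbhsr.
Unshelve. all: by end_near.
Qed.

(** The shift to [n.+1] avoids [M = 0] and turns [M%:R^-1] into [harmonic n]. *)
Lemma cvg_actuator_norm :
  ((Num.sqrt r * sinc (norm_arg n.+1))^-1) @[n --> \oo] -->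
  (Num.sqrt r * pi / (2 * sin (r * pi / 2)) : R).
Proof.
have pi0 := pi_gt0 R.
have rp : 0 < r * pi / 2 by rewrite divr_gt0 ?mulr_gt0.
have rpi : r * pi / 2 <= pi / 2 by rewrite ler_pM2r// ger_pMl// ltW.
have sp := sinc_gt0 (ltW rp) rpi.
have argE : (fun n => norm_arg n.+1) = (fun n => r * pi / 2 * (1 - harmonic n)).
  by apply/funext => n; rewrite norm_argE.
have c1 : norm_arg n.+1 @[n --> \oo] --> r * pi / 2.
  have : r * pi / 2 * (1 - harmonic n) @[n --> \oo] --> r * pi / 2 * (1 - 0).
    by apply: cvgMl_tmp; apply: cvgB; [exact: cvg_cst|exact: cvg_harmonic].
  by rewrite argE subr0 mulr1.
have -> : Num.sqrt r * pi / (2 * sin (r * pi / 2)) =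
    (Num.sqrt r * sinc (r * pi / 2))^-1.
  have s0 : 0 < sin (r * pi / 2) by rewrite sin_gt0_pi// rp/=; lra.
  have q0 : 0 < Num.sqrt r by rewrite sqrtr_gt0.
  rewrite /sinc gt_eqF//; set sn := sin _ in s0 *.
  (* Writing [r] as a square makes the identity rational in [Num.sqrt r]. *)
  have rE : r = Num.sqrt r ^+ 2 by rewrite sqr_sqrtr// ltW.
  move: sn (Num.sqrt r) pi pi0 s0 q0 rE => sn q p p0 sn0 q0 ->.
  by field; rewrite !gt_eqF.
apply: cvgV; first by rewrite gt_eqF// mulr_gt0// sqrtr_gt0.
by apply: cvgMl_tmp; apply: cvg_comp c1 (cvg_sinc rp).
Qed.

End Limit.

Unset Implicit Arguments.

Theorem theorem2p3 (R : realType) (L r : R) (L_gt0 : 0 < L) (r01 : 0 < r < 1)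
    (lam : nat -> R) (e : nat -> R -> R) (he : neumann_eigensystem L lam e) :
  let U (M : nat) : set (L2 L) := actuator_span L r M in
  let E (M : nat) : set (L2 L) := eigen_span L e M in
  let P (M : nat) : L2 L -> L2 L := oblique_proj (U M) (L2orth (E M)) in
  [/\ forall M : nat, (1 <= M)%N -> direct_sum (U M) (L2orth (E M)),
      forall M : nat, (2 <= M)%N ->
        opnorm (P M) =
          ((4 * M%:R ^+ 2 / (r * pi ^+ 2 * (M%:R - 1) ^+ 2)
            * sin (r * pi * (M%:R - 1) / (2 * M%:R)) ^+ 2) `^ (- (1 / 2)))%:E,
      forall M N : nat, (2 <= M)%N -> (M < N)%N ->
        (opnorm (P M) < opnorm (P N))%E &
      opnorm (P M) @[M --> \oo] -->
        (Num.sqrt r * pi / (2 * sin (r * pi / 2)))%:E].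
Proof.
move=> U E P; have /andP[r0 r1] := r01.
have EE M : E M = L2span (fun i : 'I_M => neumann_cosine L i).
  exact: (eigen_span_cosines L_gt0 M he).
have normP M : (1 < M)%N ->
    opnorm (P M) = ((Num.sqrt r * sinc (norm_arg r M))^-1)%:E.
  by move=> M1; rewrite /P EE; apply: actuator_opnorm => //; exact: ltnW.
split.
- by move=> M M0; rewrite EE; apply: actuator_direct_sum.
- by move=> M M1; rewrite normP// powR_sinc.
- move=> M N M1 MN; have N1 := ltn_trans M1 MN.
  have /andP[tM0 tMpi] := norm_arg_bounds r0 r1 M1.
  have /andP[tN0 tNpi] := norm_arg_bounds r0 r1 N1.
  have q0 : 0 < Num.sqrt r by rewrite sqrtr_gt0.
  have sM := sinc_gt0 (ltW tM0) tMpi; have sN := sinc_gt0 (ltW tN0) tNpi.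
  rewrite !normP// lte_fin ltf_pV2 ?posrE ?mulr_gt0// ltr_pM2l//.
  by apply: sinc_lt => //; [exact: ltW|apply: norm_arg_lt => //; exact: ltnW].
rewrite -cvg_shiftS.
have h : ((Num.sqrt r * sinc (norm_arg r n.+1))^-1)%:E @[n --> \oo] -->
    (Num.sqrt r * pi / (2 * sin (r * pi / 2)))%:E.
  by apply: cvg_EFin; [exact: nearW|exact: cvg_actuator_norm].
(* The closed form [normP] requires [1 < n.+1], hence holds only eventually. *)
apply: cvg_trans h; apply: near_eq_cvg; near=> n; rewrite /= normP// ltnS.
by near: n; exact: nbhs_infty_gt.
Unshelve. all: by end_near.
Qed.
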